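(* Let $G$ be a graph of type $\mathscr{G}_{\mathrm I}(A,B)$ with no cut vertices. Assume that either $G/(A\cup\{0\})$ is a $c$-cycle of length three in which each $B$-vertex is adjacent (in $G$) to exactly one (not necessarily the same) vertex of $A\cup\{0\}$, or $G/(A\cup\{0\})$ is a $c$-cycle of length at least four, where $c\in\mathbb{Z}^+$. Then, for some $a,b\in\mathbb{Z}^+$, one of the following holds: (i) $G$ is a $c$-cycle; (ii) $A=\{1\}$, $wt(\{0,1\})=a$, and $wt(\{i,j\})=c$ for all other edges $\{i,j\}\in E(G)$; (iii) $A=\{1,2\}$, $wt(\{0,1\})=wt(\{0,2\})=a$, possibly $\{1,2\}\in E(G)$ with $wt(\{1,2\})=b$, and $wt(\{i,j\})=c$ for all other edges $\{i,j\}\in E(G)$.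
   Context: A graph is a finite, connected, undirected, loopless multigraph with a root, viewed as a simple graph with edge-weight function $wt$ counting parallel edges. For $U\subseteq V$, $i\in U$, $d_U(i)=\sum_{j\notin U}wt(\{i,j\})$; a parking function of a rooted graph is an assignment $(b_i)$ of non-negative integers to the non-root vertices such that every non-empty set $U$ of non-root vertices contains $i$ with $b_i<d_U(i)$; $\mathcal{PF}(G)$ is their set. $G$ has type $\mathscr{G}_{\mathrm I}(A,B)$ if $V(G)=\{0\}\cup A\cup B$ with root $0$, $A=\{1,\dots,p\}$, $B=\{p+1,\dots,p+q\}$, $p,q\in\mathbb{Z}^+$; $G[\{0\}\cup A]$ is connected; and $\mathcal{PF}(G)$ is invariant under $\mathfrak{S}_p\times\mathfrak{S}_q$ acting on $(b_1,\dots,b_{p+q})$ by permuting $(b_1,\dots,b_p)$ and $(b_{p+1},\dots,b_{p+q})$ separately. A cut vertex is a vertex whose deletion disconnects $G$. $G/(A\cup\{0\})$ is obtained by identifying all of $A\cup\{0\}$ into one root vertex $\bar0$, keeping the vertices of $B$; distinct classes are adjacent iff some members are adjacent in $G$, with weight the sum of the weights of the $G$-edges between them (edges inside $A\cup\{0\}$ disappear). A $c$-cycle is a cycle all of whose edges have weight $c$. *)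

(* Defs.v *)
From mathcomp Require Import all_boot perm.

Set Implicit Arguments.
Unset Strict Implicit.
Unset Printing Implicit Defensive.

(* A finite loopless multigraph is stored as its weighted simple graph:
   [wt G x y] is the number of parallel edges joining x and y.  Connectedness
   is kept as a separate predicate, since the graphs obtained below by deleting
   vertices need not satisfy it. *)
Record mgraph (V : finType) := MGraph {
  wt : V -> V -> nat;
  wt_sym : forall x y, wt x y = wt y x;
  wt_loopless : forall x, wt x x = 0
}.

Section Graphs.
Variable V : finType.
Implicit Types (G : mgraph V) (U : {set V}).

Definition adj G : rel V := fun x y => 0 < wt G x y.

Definition connected G : bool := [forall x, forall y, connect (adj G) x y].

Definition induced G U : mgraph {x : V | x \in U} :=
  @MGraph {x : V | x \in U} (fun x y => wt G (val x) (val y))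
    (fun x y => wt_sym G (val x) (val y)) (fun x => wt_loopless G (val x)).

End Graphs.

Definition cut_vertex (V : finType) (G : mgraph V) (v : V) : bool :=
  ~~ connected (induced G [set~ v]).

Section ContractionAndCycles.
Variable V : finType.
Implicit Types (G : mgraph V) (U : {set V}).

Definition outdeg G U (i : V) : nat := \sum_(j | j \notin U) wt G i j.

(* The vertices of G/U are [None], to which all of U is identified, and
   [Some x] for x outside U; the quotient map is [insub]. *)
Definition contract_class U : V -> option {x : V | x \notin U} := insub.

Definition contract_wt G U (C D : option {x : V | x \notin U}) : nat :=
  if C == D then 0
  else \sum_(x | contract_class U x == C)
         \sum_(y | contract_class U y == D) wt G x y.

Lemma contract_wt_sym G U (C D : option {x : V | x \notin U}) :
  contract_wt G C D = contract_wt G D C.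
Proof.
rewrite /contract_wt eq_sym; case: ifP => // _; rewrite exchange_big /=.
by apply: eq_bigr => x _; apply: eq_bigr => y _; apply: wt_sym.
Qed.

Lemma contract_wt_loopless G U (C : option {x : V | x \notin U}) :
  contract_wt G C C = 0.
Proof. by rewrite /contract_wt eqxx. Qed.

Definition contract G U : mgraph (option {x : V | x \notin U}) :=
  MGraph (@contract_wt_sym G U) (@contract_wt_loopless G U).

(* The whole graph is a cycle on n vertices; [s] lists them in cyclic order. *)
Definition is_cycle (n : nat) G : Prop :=
  exists s : seq V,
    [/\ uniq s, size s = n, 3 <= n, s =i predT &
        forall x y, adj G x y = (y == next s x) || (x == next s y)].

Definition c_cycle (c n : nat) G : Prop :=
  is_cycle n G /\ forall x y, adj G x y -> wt G x y = c.

End ContractionAndCycles.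

(* On the vertex set {0, ..., n} the root is 0 = [ord0], and the non-root
   vertex k+1 is [lift ord0 k], so [b k] below is the value at vertex k+1. *)
Definition parking (n : nat) (G : mgraph 'I_n.+1) (b : 'I_n -> nat) : Prop :=
  forall U : {set 'I_n.+1}, U != set0 -> ord0 \notin U ->
    exists i : 'I_n,
      lift ord0 i \in U /\ b i < outdeg G U (lift ord0 i).

Definition Aset (p q : nat) : {set 'I_(p + q).+1} :=
  [set i : 'I_(p + q).+1 | 1 <= i <= p].
Definition Bset (p q : nat) : {set 'I_(p + q).+1} :=
  [set i : 'I_(p + q).+1 | p + 1 <= i <= p + q].

Definition block_perm (p q : nat) (s : 'S_p) (t : 'S_q) (i : 'I_(p + q)) :
    'I_(p + q) :=
  match split i with
  | inl j => lshift q (s j)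
  | inr k => rshift p (t k)
  end.

Definition typeI (p q : nat) (G : mgraph 'I_(p + q).+1) : Prop :=
  [/\ 0 < p, 0 < q, connected (induced G (ord0 |: Aset p q)) &
      forall (s : 'S_p) (t : 'S_q) (b : 'I_(p + q) -> nat),
        parking G (fun i => b (block_perm s t i)) <-> parking G b].

(* Main.v *)
(* Call an ordering of the vertices starting at the root and in which every
   vertex is joined to an earlier one a burning order; the indegrees along such
   orders, minus one, are exactly the parking functions of maximal sum.  Hence
   swapping two values inside A, or inside B, turns indegrees of a burning order
   into those of another one, in G and also in G[M], where M = {0} + A.

   Burning a vertex of A last shows that all vertices of A have the same degree
   d.  Swapping the two kinds of vertices of B shows that each end of the path B
   is joined to a single vertex of M, by weight c; the absence of cut vertices
   makes these two vertices of M distinct.  Let T be the set they form.  Inside M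
   a vertex of A has degree d, or d - c if it lies in T, so swapping shows that
   every burning order of M ends in T with value d - c, the largest possible.

   Suppose all values are d - c for all burning orders of M.  Then all weights
   in M are 0 or d - c, and counting edges gives d = 2c: all degrees of G are 2c
   and G is a c-cycle.  This happens when the root is in T, and also when
   |A| > 2: otherwise each burning order has exactly one deficient value mu,
   which can be moved to any vertex; the first vertex after the root must carry
   it, so all weights from the root are mu and all weights in A are d - c - mu,
   making the third value of an order exceed d - c. *)

Require Import Defs.
From mathcomp Require Import all_boot perm zify.

Set Implicit Arguments.
Unset Strict Implicit.
Unset Printing Implicit Defensive.

(** * Burning orders *)

Lemma eq_sum_of_leq (I : finType) (P : pred I) (E F : I -> nat) :
  (forall i, P i -> E i <= F i) -> \sum_(i | P i) E i = \sum_(i | P i) F i ->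
  forall i, P i -> E i = F i.
Proof.
move=> leEF eqEF i Pi.
have /leqif_sum H : forall i, P i -> E i <= F i ?= iff (E i == F i).
  by move=> j Pj; split=> //; exact: leEF.
by case: H => _; rewrite eqEF eqxx => /esym/forall_inP/(_ i Pi)/eqP.
Qed.

Section Orders.
Variables (V : finType) (G : mgraph V).
Implicit Types (s t : seq V) (r i j u v : V) (S W : {set V}).

(** Connectedness of [G[W]] as a cut condition on subsets of [V], so that orders of [W] remain
    sequences in [V] rather than in a subtype. *)
Definition linked W := forall S, S != set0 -> S \proper W ->
  exists i j, [/\ i \in S, j \in W :\: S & 0 < wt G i j].

(* When i does not occur in s, this is its total weight to s. *)
Fixpoint indeg s i : nat :=
  if s is j :: s' then if j == i then 0 else wt G j i + indeg s' i else 0.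

Lemma indeg_catl s t i : i \in s -> indeg (s ++ t) i = indeg s i.
Proof.
elim: s => //= j s IHs; rewrite inE eq_sym; case: eqVneq => //= _ /IHs->.
by [].
Qed.

Lemma indeg_catr s t i :
  i \notin s -> indeg (s ++ t) i = \sum_(j <- s) wt G j i + indeg t i.
Proof.
elim: s => [|j s IHs] /=; first by rewrite big_nil.
by rewrite inE negb_or eq_sym big_cons -addnA => /andP[/negPf-> /IHs->].
Qed.

Lemma indeg_rcons s i :
  i \notin s -> indeg (rcons s i) i = \sum_(j <- s) wt G j i.
Proof. by move=> si; rewrite -cats1 indeg_catr //= eqxx addn0. Qed.

Lemma indeg_filter (P : pred V) s i : P i -> indeg (filter P s) i <= indeg s i.
Proof.
move=> Pi; elim: s => //= j s IHs; case: ifP => [_|Pj] /=.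
  by case: eqVneq => // _; rewrite leq_add2l.
by case: eqVneq => [ji|_]; [rewrite -ji Pj in Pi | rewrite (leq_trans IHs) ?leq_addl].
Qed.

(** Each edge inside [s] is counted once on the left, at its later end, and twice on the right.
    Hence the sum of the indegrees does not depend on the order. *)
Lemma sum_indeg s : uniq s ->
  2 * \sum_(i <- s) indeg s i = \sum_(i <- s) \sum_(j <- s) wt G i j.
Proof.
elim: s => [|i s IHs] /=; first by rewrite !big_nil.
case/andP=> si /IHs {}IHs; rewrite !big_cons eqxx wt_loopless !add0n.
have -> : \sum_(k <- s) \sum_(j <- i :: s) wt G k j =
          \sum_(k <- s) wt G i k + 2 * \sum_(j <- s) indeg s j.
  rewrite IHs -big_split; apply: eq_bigr => k _.
  by rewrite big_cons wt_sym.
have -> : \sum_(j <- s) (if i == j then 0 else wt G i j + indeg s j) =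
          \sum_(j <- s) (wt G i j + indeg s j).
  by apply: eq_big_seq => j sj; case: eqVneq => // ij; rewrite ij sj in si.
by rewrite big_split /= mulnDr mul2n -addnn addnA.
Qed.

Lemma sum_indeg_set s W : uniq s -> s =i W ->
  2 * \sum_(i in W) indeg s i = \sum_(i in W) \sum_(j in W) wt G i j.
Proof.
move=> Us sW; have WE F : \sum_(i in W) F i = \sum_(i <- s) F i.
  by rewrite -(eq_bigl _ _ sW) big_uniq.
by rewrite !WE sum_indeg //; apply: eq_bigr => i _; rewrite WE.
Qed.

Lemma leq_sum_seq_set (F : V -> nat) s W : uniq s -> {subset s <= W} ->
  \sum_(j <- s) F j <= \sum_(j in W) F j.
Proof.
move=> Us sW; rewrite big_uniq //= [leqRHS](bigID (mem s)) /=.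
rewrite -[leqLHS]addn0 leq_add //; apply/eq_leq/eq_bigl => j.
by case sj: (j \in s); rewrite ?andbF ?andbT ?sW.
Qed.

Lemma indeg_le_sum s W i : uniq s -> {subset s <= W} ->
  indeg s i <= \sum_(j in W) wt G j i.
Proof.
move=> Us sW; apply: (leq_trans _ (leq_sum_seq_set _ Us sW)).
elim: s {Us sW} => //= j s IHs; rewrite big_cons.
by case: eqP => // _; rewrite leq_add2l.
Qed.

(** Append vertices one at a time. The threshold [g] is general enough for two uses: 1 off the root
    for burning orders, and [b] plus one for a parking function [b]. *)
Lemma greedy_order (g : V -> nat) W s r :
  uniq s -> r \in s -> {subset s <= W} ->
  (forall i, i \in s -> g i <= indeg s i) ->
  (forall S, r \in S -> S \proper W ->
     exists2 i, i \in W :\: S & g i <= \sum_(j in S) wt G j i) ->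
  exists t, [/\ uniq (s ++ t), s ++ t =i W &
                forall i, i \in s ++ t -> g i <= indeg (s ++ t) i].
Proof.
move=> + + + + grow; have [n] := ubnP (#|W| - size s).
elim: n s => // n IHn s lt_n Us rs sW gs.
case: (boolP (W \subset [set j in s])) => [Ws|nWs].
  exists [::]; rewrite cats0; split=> // i; apply/idP/idP => [/sW //|/(subsetP Ws)].
  by rewrite inE.
have prs : [set j in s] \proper W.
  by rewrite properE nWs andbT; apply/subsetP=> j; rewrite inE => /sW.
have [|i] := grow _ _ prs; first by rewrite inE.
rewrite !inE => /andP[si Wi] gi.
have {}gi : g i <= \sum_(j <- s) wt G j i.
  by rewrite big_uniq //; congr (_ <= _): gi; apply: eq_bigl => j; rewrite inE.
have lt_sW : size s < #|W|.
  by have := proper_card prs; rewrite cardsE; move/card_uniqP: Us => ->.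
have [|||||t [Ut tW gt]] := IHn (rcons s i).
- by rewrite size_rcons; lia.
- by rewrite rcons_uniq si.
- by rewrite mem_rcons inE rs orbT.
- by move=> j; rewrite mem_rcons inE => /predU1P[->|/sW].
- move=> j; rewrite mem_rcons inE => /predU1P[->|sj]; first by rewrite indeg_rcons.
  by rewrite -cats1 indeg_catl ?gs.
by exists (i :: t); rewrite -cat_rcons.
Qed.

(** That [r] comes first need not be demanded: the first entry has indegree 0. *)
Definition burning r s :=
  [/\ uniq s, r \in s & forall i, i \in s -> i != r -> 0 < indeg s i].

Lemma burning_head r s : burning r s -> exists s', s = r :: s'.
Proof.
case: s => [|i s] [_ // _ /(_ i)]; rewrite mem_head /= eqxx.
by case: eqVneq => [->|_ /(_ isT isT) //]; exists s.
Qed.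

Lemma burning_root r s : burning r s -> indeg s r = 0.
Proof. by case/burning_head=> s' -> /=; rewrite eqxx. Qed.

Lemma burning1 r : burning r [:: r].
Proof. by split=> // [|i]; rewrite inE // => ->. Qed.

Lemma burning_prefix r s t : s != [::] -> burning r (s ++ t) -> burning r s.
Proof.
case: s => // i s _ b; have [s' [ir _]] := burning_head b; subst i.
case: b => Us _ pos; split.
- by move: Us; rewrite cat_uniq => /andP[].
- exact: mem_head.
- move=> j sj /(pos j); rewrite mem_cat sj indeg_catl //; exact.
Qed.

Lemma burning_rcons r s i : burning r s -> i \notin s ->
  0 < \sum_(j <- s) wt G j i -> burning r (rcons s i).
Proof.
case=> Us rs pos si gt0; split=> [||j].
- by rewrite rcons_uniq si.
- by rewrite mem_rcons inE rs orbT.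
- rewrite mem_rcons inE => /predU1P[-> _|sj]; first by rewrite indeg_rcons.
  by rewrite -cats1 indeg_catl //; apply: pos.
Qed.

Lemma burning_extend r s W : linked W -> burning r s -> {subset s <= W} ->
  exists t, burning r (s ++ t) /\ s ++ t =i W.
Proof.
move=> linkW [Us rs pos] sW.
have [||t [Ut tW gt]] := @greedy_order (fun i => i != r) W s r Us rs sW.
- by move=> i si; case: eqVneq => // ir; apply: pos.
- move=> S rS /linkW[|i [j [Si Wj wij]]]; first by apply/set0Pn; exists r.
  exists j => //; apply: (leq_trans (leq_b1 _)).
  by rewrite (bigD1 i) //= addn_gt0 wij.
exists t; split=> //; split=> //; first by rewrite mem_cat rs.
by move=> i /gt; case: eqVneq.
Qed.

(** If no edge left [S], then [S] would be closed under [connect]. *)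
Lemma connected_linked : connected G -> linked setT.
Proof.
move=> /forallP conn S /set0Pn[i Si] /properP[_ [j _ Sj]].
case: (pickP [pred ij : V * V | [&& ij.1 \in S, ij.2 \notin S & adj G ij.1 ij.2]]).
  by case=> u v /= /and3P[Su Sv uv]; exists u, v; rewrite !inE Sv.
move=> no; have adj_sym : symmetric (adj G) by move=> u v; rewrite /adj wt_sym.
have : connect (adj G) i j by have /forallP := conn i.
have clS : closed (adj G) S.
  apply: intro_closed => [|u v uv Su]; first exact: sym_connect_sym.
  by have := no (u, v); rewrite /= Su uv andbT => /negbFE.
by move/(closed_connect clS); rewrite Si (negPf Sj).
Qed.

End Orders.

Lemma induced_linked (V : finType) (G : mgraph V) (W : {set V}) :
  connected (induced G W) -> linked G W.
Proof.
move=> /connected_linked linkW S /set0Pn[i Si] /properP[/subsetP SW [j Wj Sj]].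
have [||u [v []]] := linkW [set x | val x \in S].
- by apply/set0Pn; exists (Sub i (SW _ Si)); rewrite inE SubK.
- by apply/properP; split=> //; exists (Sub j Wj); rewrite ?inE ?SubK.
rewrite !inE andbT => Su Sv uv.
by exists (val u), (val v); split; rewrite // inE Sv (valP v).
Qed.

(** * Orders of the root side *)

Lemma perm_on_tperm (T : finType) (A : {set T}) i j v : i \in A -> j \in A ->
  (tperm i j v \in A) = (v \in A).
Proof. by move=> Ai Aj; case: tpermP => [->|->|//]; rewrite Ai Aj. Qed.

Section Core.
Variables (V : finType) (G : mgraph V) (r : V) (A T : {set V}) (c d : nat).

Definition ordering (W : {set V}) (s : seq V) := burning G r s /\ s =i W.

(** The symmetry is phrased with indegrees of orderings, a form that passes from [setT] to smaller
    [W]. *)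
Definition swappable (W : {set V}) := forall s i j, ordering W s ->
  i \in A -> j \in A ->
  exists2 s', ordering W s' &
    forall v, v \in W -> indeg G s' v = indeg G s (tperm i j v).

Local Notation M := (r |: A).
Definition wdeg (W : {set V}) v := \sum_(u in W) wt G u v.

Hypotheses (rA : r \notin A) (linkM : linked G M) (swapM : swappable M).
Hypotheses (TM : T \subset M) (T2 : #|T| = 2) (c_gt0 : 0 < c).
(** Here [d] is the common degree in the whole graph of the vertices of [A], and [c * (v \in T)] is
    the weight from [v] to the outside of [M]. *)
Hypothesis degM : forall v, v \in A -> wdeg M v + c * (v \in T) = d.

Lemma mem_nonroot v : v \in M -> (v \in A) = (v != r).
Proof. by case: eqVneq => [->|]; rewrite ?(negPf rA) // !inE => /negPf->. Qed.

Lemma nonroot_mem v : v \in A -> v \in M. Proof. by rewrite !inE orbC => ->. Qed.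

Lemma swap_at s i j : ordering M s -> i \in A -> j \in A ->
  exists2 s', ordering M s' &
    forall v, v \in A -> indeg G s' v = indeg G s (tperm i j v).
Proof.
by move=> os Ai Aj; have [s' os' E] := swapM os Ai Aj; exists s' => // v /nonroot_mem/E.
Qed.

Lemma indeg_ordering s v : ordering M s -> indeg G s v <= wdeg M v.
Proof. by case=> [[Us _ _] sM]; apply: indeg_le_sum => // j; rewrite sM. Qed.

Lemma T_nonroot : exists2 t, t \in T & t \in A.
Proof.
have : 0 < #|T :\ r| by have := cardsD1 r T; case: (r \in T); lia.
case/card_gt0P=> t; rewrite !inE => /andP[tr Tt]; exists t => //.
by rewrite mem_nonroot ?(subsetP TM).
Qed.

(** A swap carries the value of [i] to a vertex of [T] in [A], whose whole degree inside [M] is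
    [d - c]. *)
Lemma indeg_max s i : ordering M s -> i \in A -> indeg G s i + c <= d.
Proof.
move=> os Ai; have [t Tt At] := T_nonroot; have [s' os' E] := swap_at os Ai At.
have := indeg_ordering t os'; have := degM At.
by rewrite E // tpermR Tt; lia.
Qed.

(** The last vertex has its whole degree in [M] as value, which is [d] or [d - c]; [indeg_max]
    excludes [d], so the vertex lies in [T]. *)
Lemma ordering_last s : ordering M s ->
  exists t, [/\ t \in T, t \in A & indeg G s t + c = d].
Proof.
move=> os; case: (lastP s) os => [|s' v] os.
  by have := os.2 r; rewrite !inE eqxx.
have [[Us _ _] sM] := os; have vs' : v \notin s' by move: Us; rewrite rcons_uniq => /andP[].
have Av : v \in A.
  rewrite mem_nonroot -?sM ?mem_rcons ?mem_head //; apply/eqP => vr.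
  have [s'' Es] := burning_head os.1; have [t _ At] := T_nonroot.
  case: s' Es {Us os} sM vs' => [_ sM|u s' [-> _] _]; last by rewrite vr mem_head.
  by have := sM t; rewrite inE (nonroot_mem At) => /eqP tv; rewrite tv vr (negPf rA) in At.
have degv : indeg G (rcons s' v) v = wdeg M v.
  rewrite indeg_rcons // /wdeg -(eq_bigl _ _ sM) -big_uniq // big_rcons.
  by rewrite wt_loopless /= addn0.
have := indeg_max os Av; have := degM Av; rewrite degv.
by case Tv: (v \in T) => E ?; exists v => //; [split=> //; rewrite degv; lia | lia].
Qed.

Lemma extend_to_ordering s : burning G r s -> {subset s <= M} -> exists t, ordering M (s ++ t).
Proof. by move=> bs sM; have [t []] := burning_extend linkM bs sM; exists t. Qed.

Lemma ordering_exists : exists s, ordering M s.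
Proof.
have [|t] := @extend_to_ordering [:: r] (burning1 G r); last by exists ([:: r] ++ t).
by move=> v; rewrite !inE => ->.
Qed.

Definition saturated := forall s i, ordering M s -> i \in A -> indeg G s i + c = d.

(** Now [T] has a single vertex [t] in [A], and [t] has value [d - c] in every ordering; any other
    value can be swapped onto [t]. *)
Lemma saturated_root : r \in T -> saturated.
Proof.
move=> Tr s i os Ai; have [t Tt At] := T_nonroot.
have Tuniq u : u \in T -> u \in A -> u = t.
  move=> Tu Au; have /eqP/cards1P[v Ev] : #|T :\ r| = 1 by have := cardsD1 r T; rewrite Tr; lia.
  have mem w : w \in T -> w \in A -> w = v.
    by move=> Tw Aw; apply/set1P; rewrite -Ev !inE Tw andbT -mem_nonroot ?nonroot_mem.
  by rewrite (mem u) // (mem t).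
have [s' os' E] := swap_at os Ai At; have [u [/Tuniq Tu /Tu-> ]] := ordering_last os'.
by rewrite E // tpermR.
Qed.

(** * Orderings when [T] misses the root *)

Section Avoiding.
Hypotheses (TA : T \subset A) (A3 : 2 < #|A|).

(* Two deficient values could be swapped onto the two elements of T, but every
   ordering ends in T, where the last value is d - c. *)
Lemma deficient_unique s i j : ordering M s -> i \in A -> j \in A -> i != j ->
  indeg G s i + c < d -> indeg G s j + c = d.
Proof.
move=> os Ai Aj ij si; apply/eqP; rewrite eqn_leq indeg_max // leqNgt; apply/negP=> sj.
have /cards2P[x [y [xy ET]]] : #|T| == 2 by rewrite T2.
have [Ax Ay] : x \in A /\ y \in A by split; apply: (subsetP TA); rewrite ET !inE eqxx ?orbT.
have [s1 os1 E1] := swap_at os Ai Ax.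
pose j1 := tperm i x j.
have Aj1 : j1 \in A by rewrite perm_on_tperm.
have j1x : x != j1 by rewrite -{1}(tpermL i x) (inj_eq perm_inj).
have s1x : indeg G s1 x + c < d by rewrite E1 // tpermR.
have s1j : indeg G s1 j1 + c < d by rewrite E1 // tpermK.
have [s2 os2 E2] := swap_at os1 Aj1 Ay.
have [t []] := ordering_last os2; rewrite ET !inE => /orP[]/eqP-> _; rewrite E2 //.
  by rewrite tpermD 1?eq_sym // => E; rewrite E ltnn in s1x.
by rewrite tpermR => E; rewrite E ltnn in s1j.
Qed.

Lemma saturated_avoiding : saturated.
Proof.
move=> s0 i0 os0 Ai0; apply/eqP; rewrite eqn_leq indeg_max // leqNgt; apply/negP.
set mu := indeg G s0 i0 => mu_lt.
have mu_at i : i \in A -> exists2 s, ordering M s & indeg G s i = mu.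
  by move=> Ai; have [s os E] := swap_at os0 Ai0 Ai; exists s; rewrite // E // tpermR.
(* All other values are [d - c] and the total is the number of edges in [M], so the deficient value
   is the same in every ordering. *)
have defect s i : ordering M s -> i \in A -> indeg G s i + c < d -> indeg G s i = mu.
  move=> os Ai si; have [s' os' Es'] := mu_at i Ai.
  have sumM s1 : ordering M s1 -> indeg G s1 i + c < d ->
      2 * (indeg G s1 i + \sum_(j in A | j != i) (d - c)) =
      \sum_(u in M) \sum_(v in M) wt G u v.
    move=> os1 lt1; have [[Us1 _ _] s1M] := os1; rewrite -(sum_indeg_set G Us1 s1M); congr (2 * _).
    rewrite big_setU1 //= [in RHS](bigD1 i) //=.
    rewrite (burning_root os1.1) add0n; congr (_ + _).
    apply: eq_bigr => j /andP[Aj ji].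
    have := @deficient_unique s1 i j os1 Ai Aj; rewrite eq_sym => /(_ ji lt1).
    by lia.
  have := sumM _ os si; rewrite -(sumM _ os') ?Es' //; lia.
have neq_r u : u \in A -> (r == u) = false.
  by case: eqVneq => // <-; rewrite (negPf rA).
have burn1 u : u \in A -> 0 < wt G r u -> burning G r [:: r; u].
  move=> Au ru; apply: (burning_rcons (burning1 G r)); last by rewrite big_seq1.
  by rewrite inE eq_sym neq_r.
(* Placed right after the root, [u] has value [wt G r u]. Were this at least [d - c], then [u],
   always preceded by [r], could never take the smaller value [mu]. *)
have nbr u : u \in A -> 0 < wt G r u -> wt G r u = mu.
  move=> Au ru; have [|t ot] := extend_to_ordering (burn1 u Au ru).
    by move=> v; rewrite !inE => /orP[]/eqP->; rewrite ?eqxx ?Au ?orbT.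
  have Eu : indeg G ([:: r; u] ++ t) u = wt G r u by rewrite /= neq_r // eqxx addn0.
  case: (ltnP (wt G r u + c) d) => ltd; first by rewrite -Eu (defect _ _ ot) ?Eu.
  have [s os Es] := mu_at u Au; have [s' Er] := burning_head os.1.
  by move: Es; rewrite Er /= neq_r //; lia.
(* In an ordering with value [mu] at [u], the vertex right after the root also has value [mu]; by
   uniqueness of the deficient vertex it is [u]. *)
have all_nbr u : u \in A -> 0 < wt G r u /\ wt G r u = mu.
  move=> Au; have [s os Es] := mu_at u Au; have [s' Er] := burning_head os.1.
  case: s' Er => [|v t] Er; subst s.
    by have := os.2 u; rewrite inE (nonroot_mem Au) eq_sym neq_r.
  have [[Us _ pos] sM] := os.
  have vr : v != r by move: Us; rewrite /= inE negb_or eq_sym -andbA => /andP[].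
  have Av : v \in A by rewrite mem_nonroot // -sM !inE eqxx orbT.
  have Ev : indeg G [:: r, v & t] v = wt G r v by rewrite /= neq_r // eqxx addn0.
  have rv : 0 < wt G r v by rewrite -Ev pos // !inE eqxx orbT.
  have Emu := nbr v Av rv; case: (eqVneq v u) => [<- //|vu].
  by have := deficient_unique os Av Au vu; rewrite Ev Emu Es; lia.
have burn2 u v : u \in A -> v \in A -> u != v -> burning G r [:: r; u; v].
  move=> Au Av uv; have [ru _] := all_nbr u Au; have [rv _] := all_nbr v Av.
  apply: (burning_rcons (burn1 u Au ru)); last by rewrite !big_cons addn_gt0 rv.
  by rewrite !inE negb_or eq_sym neq_r // eq_sym.
(* In an ordering starting with [r, u, v] the deficient vertex is [u], so [v] has value [d - c]. *)
have pair u v : u \in A -> v \in A -> u != v -> mu + wt G u v + c = d.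
  move=> Au Av uv; have [|t ot] := extend_to_ordering (burn2 u v Au Av uv).
    by move=> w; rewrite !inE => /or3P[]/eqP->; rewrite ?eqxx ?Au ?Av ?orbT.
  have := deficient_unique ot Au Av uv; rewrite /= !neq_r // eqxx (negPf uv) eqxx !addn0.
  by rewrite !(all_nbr _ _).2 // => ->.
have /card_gt2P[x [y [z [[Ax Ay Az] [xy yz zx]]]]] := A3.
have [rz Erz] := all_nbr z Az.
(* Here [z] gets [mu + 2 * (d - c - mu)], which exceeds [d - c]. *)
have [|v|t ot] := @extend_to_ordering [:: r; x; y; z].
- apply: (burning_rcons (burn2 x y Ax Ay xy)); last by rewrite !big_cons addn_gt0 rz.
  by rewrite !inE !negb_or eq_sym neq_r // zx eq_sym.
- by rewrite !inE => /or4P[]/eqP->; rewrite ?eqxx ?Ax ?Ay ?Az ?orbT.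
have := indeg_max ot Az; rewrite /= neq_r // eq_sym (negPf zx) (negPf yz) eqxx Erz.
have := pair x z Ax Az; have := pair y z Ay Az yz; rewrite eq_sym zx => ? /(_ isT).
by lia.
Qed.
End Avoiding.

(** * Consequences of saturation *)

Section Saturated.
Hypothesis sat : saturated.

Lemma prefix_weight s v : burning G r s -> {subset s <= M} -> v \in A -> v \notin s ->
  \sum_(u <- s) wt G u v = 0 \/ \sum_(u <- s) wt G u v + c = d.
Proof.
move=> bs sM Av vs; have [->|] := posnP (\sum_(u <- s) wt G u v); first by left.
move=> gt0; right; have [|t ot] := extend_to_ordering (burning_rcons bs vs gt0).
  by move=> u; rewrite mem_rcons inE => /predU1P[->|/sM //]; rewrite nonroot_mem.
by have := sat ot Av; rewrite indeg_catl ?mem_rcons ?mem_head // indeg_rcons.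
Qed.

(** With [u] before [v], the weight is the difference of the weights to [v] from the prefixes with
    and without [u], and each of these is 0 or [d - c]. *)
Lemma saturated_wt u v : u \in M -> v \in M -> wt G u v = 0 \/ wt G u v + c = d.
Proof.
have [s os] := ordering_exists; have [[Us rs _] sM] := os; rewrite -!sM.
wlog lt_uv : u v / index u s < index v s => [IH su sv|].
  case: (ltngtP (index u s) (index v s)) => [lt|lt|Euv]; first exact: IH.
    by rewrite wt_sym; apply: IH.
  by left; rewrite -(nth_index u su) Euv nth_index // wt_loopless.
move=> su sv; have Av : v \in A.
  rewrite mem_nonroot -?sM //; apply: contraTneq lt_uv => ->.
  by have [s' ->] := burning_head os.1; rewrite /= eqxx.
have [s1 [s2 Es]] : exists s1 s2, s = rcons s1 u ++ s2.
  by case/splitPr: su => s1 s2; exists s1, s2; rewrite cat_rcons.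
move: Us; rewrite Es cat_uniq rcons_uniq => /andP[/andP[us1 _] _].
have vs1 : v \notin rcons s1 u.
  apply: contraL lt_uv => v_in; rewrite Es !index_cat v_in mem_rcons mem_head -leqNgt.
  rewrite -(cats1 s1) [index u _]index_cat (negPf us1) /= eqxx addn0.
  by rewrite -ltnS -[X in _ < X]addn1 -(size_cat s1 [:: u]) index_mem cats1.
have sub1 : {subset rcons s1 u <= M} by move=> w ws; rewrite -sM Es mem_cat ws.
have b1 : burning G r (rcons s1 u).
  by apply: (@burning_prefix _ _ _ _ s2); rewrite -?Es; [case: (s1) | apply: os.1].
have := prefix_weight b1 sub1 Av vs1; rewrite -cats1 big_cat big_seq1 /=.
(* The empty prefix, which occurs when [u] is the root, is not a burning order. *)
case: (eqVneq s1 [::]) => [-> | s1_n0]; first by rewrite big_nil.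
have b0 : burning G r s1.
  by apply: (@burning_prefix _ _ _ _ (u :: s2)); rewrite // -cat_rcons -Es; apply: os.1.
have vs0 : v \notin s1 by apply: contra vs1 => v1; rewrite mem_rcons inE v1 orbT.
have sub0 : {subset s1 <= M} by move=> w ws; apply: sub1; rewrite mem_rcons inE ws orbT.
have := prefix_weight b0 sub0 Av vs0.
by move: (\sum_(_ <- s1) _) (wt G u v) => P w; clear; lia.
Qed.

(** All weights in [M] are multiples of [m = d - c]. The vertex [z] has degree [m + c] inside [M],
    so [m] divides [c], and a count of edges in multiples of [m] leaves only [c = m]. *)
Lemma saturated_balance :
    (exists2 z, z \in A & z \notin T) ->
    (r \notin T -> exists u v, [/\ u \in A, v \in A, u != v, 0 < wt G r u & 0 < wt G r v]) ->
  d = 2 * c /\ wdeg M r + c * (r \in T) = d.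
Proof.
move=> [z Az Tz] twin; pose m := d - c.
have [s os] := ordering_exists; have [t [Tt At Et]] := ordering_last os.
have [[Us _ pos] sM] := os.
have m_gt0 : 0 < m.
  by have := pos t; rewrite sM nonroot_mem // -mem_nonroot ?nonroot_mem // At => /(_ isT isT); rewrite /m; lia.
have dE : d = m + c by rewrite /m; lia.
have m_wt u v : u \in M -> v \in M -> m %| wt G u v.
  move=> Mu Mv; case: (saturated_wt Mu Mv) => [->|Em]; first exact: dvdn0.
  by rewrite (_ : wt G u v = m) // /m; lia.
have m_wdeg v : v \in M -> m %| wdeg M v.
  by move=> Mv; apply: dvdn_sum => u Mu; apply: m_wt.
have /dvdnP[l El] : m %| c.
  have := m_wdeg z (nonroot_mem Az); have := degM Az; rewrite (negPf Tz) muln0 addn0 dE => ->.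
  by rewrite dvdn_addr.
have [/dvdnP[k Ek]] := m_wdeg r (setU11 _ _).
(* Twice the number of edges in [M], by degrees and by indegrees, the latter being 0 at the root and
   [m] on [A]. *)
have sumM : wdeg M r + #|A| * d = 2 * (#|A| * m) + c * #|T :&: A|.
  have := sum_indeg_set G Us sM; rewrite [\sum_(i in M) indeg G s i]big_setU1 //=.
  rewrite (burning_root os.1) add0n (eq_bigr (fun=> m)); last first.
    by move=> i Ai; have := sat os Ai; rewrite /m; lia.
  rewrite sum_nat_const => ->; rewrite big_setU1 //=.
  have -> : #|T :&: A| = \sum_(i in A) (i \in T).
    rewrite -sum1_card (eq_bigl (fun i => (i \in A) && (i \in T))).
      by rewrite big_mkcondr; apply: eq_bigr => i _; case: (i \in T).
    by move=> i; rewrite inE andbC.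
  rewrite big_distrr /= -addnA -big_split /=; congr (_ + _).
    by apply: eq_bigr => u _; rewrite wt_sym.
  rewrite -sum_nat_const; apply: eq_bigr => v Av; rewrite -(degM Av).
  by congr (_ + _); apply: eq_bigr => u _; rewrite wt_sym.
have TA2 : #|T :&: A| + (r \in T) = 2.
  rewrite -T2 (cardsD1 r T) addnC; congr (_ + #|pred_of_set _|); apply/setP=> u; rewrite !inE andbC.
  by case Tu: (u \in T); rewrite ?andbF ?andbT // mem_nonroot // (subsetP TM).
have ltTA : #|T :&: A| < #|A|.
  apply: proper_card; apply/properP; split; first exact: subsetIr.
  by exists z; rewrite // inE (negPf Tz).
have Mr : r \in M by rewrite setU11.
(* If [r] is in [T], one neighbour in [M] suffices; otherwise the two neighbours from [twin] each
   contribute at least [m]. *)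
have k_gt : 1 < k + (r \in T).
  case Tr: (r \in T).
    have [||i [j [/set1P-> Mj wrj]]] := linkM (S := [set r]).
    - by apply/set0Pn; exists r; rewrite inE.
    - apply/properP; rewrite sub1set; split=> //; exists z; rewrite ?nonroot_mem // inE.
      by rewrite -mem_nonroot ?nonroot_mem.
    case/setDP: Mj => Mj _.
    have : 0 < wdeg M r by rewrite /wdeg (bigD1 j Mj) /= (wt_sym G j r) addn_gt0 wrj.
    by rewrite Ek muln_gt0 addn1 ltnS => /andP[].
  have [u [v [Au Av uv ru rv]]] := twin (negbT Tr).
  have geM w : w \in A -> 0 < wt G r w -> m <= wt G w r.
    by move=> Aw; rewrite wt_sym => rw; exact: dvdn_leq rw (m_wt _ _ (nonroot_mem Aw) Mr).
  have : 2 * m <= wdeg M r.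
    rewrite /wdeg (bigD1 u) ?nonroot_mem //= (bigD1 v) /= ?nonroot_mem 1?eq_sym //.
    by rewrite mul2n -addnn leq_add ?geM // (leq_trans (geM v Av rv)) ?leq_addr.
  by rewrite Ek leq_pmul2r // addn0.
have l_gt0 : 0 < l by move: c_gt0; rewrite El; case: (l).
have eq_kl : k + #|A| * l = #|A| + l * #|T :&: A|.
  move: sumM; rewrite Ek dE El; clear -m_gt0 => H.
  by apply/eqP; rewrite -(eqn_pmul2r m_gt0); apply/eqP; lia.
have [a Ea] : exists a, #|A| = #|T :&: A| + a.+1.
  by exists (#|A| - #|T :&: A|.+1); lia.
have [l' El'] : exists l', l = l'.+1 by exists l.-1; lia.
(* By [k_gt] and [TA2] the right side is at most [k], hence [l' = 0], that is, [c = m]. *)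
have : k + a * l' + l' = #|T :&: A| by move: eq_kl; rewrite Ea El'; lia.
move: El' k_gt TA2; rewrite Ek dE El; clear; case: (r \in T) => -> /= k_gt TA2 H.
  have [-> ->] : l' = 0 /\ k = 1 by lia.
  by lia.
have [-> ->] : l' = 0 /\ k = 2 by lia.
by lia.
Qed.
End Saturated.
End Core.

(** * Cycles and the quotient *)

Lemma next_neq_prev (T : eqType) (s : seq T) x :
  uniq s -> 2 < size s -> x \in s -> next s x != prev s x.
Proof.
move=> Us s3 sx; apply/eqP=> E; have := next_prev Us x; rewrite -E.
have [i s' Es] := rot_to sx; rewrite -!(next_rot i Us) Es.
move: Us s3; rewrite -(rot_uniq i) -(size_rot i) Es.
case: s' {Es} => [|y [|z s']] //= /and3P[]; rewrite !inE => /norP[xy /norP[xz _]] _ _ _.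
by rewrite eqxx [y == x]eq_sym (negPf xy) eqxx => zx; rewrite zx eqxx in xz.
Qed.

Section Cycles.
Variables (V : finType) (G : mgraph V).

Lemma adj_sym : symmetric (adj G). Proof. by move=> x y; rewrite /adj wt_sym. Qed.

Lemma adj_irrefl x : adj G x x = false. Proof. by rewrite /adj wt_loopless. Qed.

(* Prolong the path at its head x until both neighbours of x lie on it. *)
Lemma path_to_cycle x s : (forall v, #|[set u | adj G v u]| = 2) ->
  path (adj G) x s -> uniq (x :: s) ->
  exists t, [/\ uniq t, cycle (adj G) t & 2 < size t].
Proof.
move=> deg2; have [n] := ubnP (#|V| - size s).
elim: n x s => // n IHn x s ltn ps Us.
have ltV : size s < #|V| by have := uniq_leq_size Us (fun y _ => mem_enum V y); rewrite -cardE.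
have /eqP/cards2P[y [z [yz Exy]]] := deg2 x.
have nb u : (u \in [set y; z]) = adj G x u by rewrite -Exy inE.
case: (boolP ([set y; z] \subset s)) => [sub|/subsetPn[u]]; last first.
  rewrite nb => xu su; apply: (IHn u (x :: s)); first by rewrite -ltnS subnS prednK ?subn_gt0.
    by rewrite /= adj_sym xu.
  rewrite cons_uniq Us andbT inE negb_or su andbT.
  by apply: contraTneq xu => ->; rewrite adj_irrefl.
(* Both neighbours of [x] lie on the path and one of them is not its next vertex; closing up there
   gives length at least three. *)
have [w xw sw] : exists2 w, adj G x w & w \in behead s.
  have sy : y \in s by apply: (subsetP sub); rewrite !inE eqxx.
  have sz : z \in s by apply: (subsetP sub); rewrite !inE eqxx orbT.
  move: sy sz {sub Us ps ltn ltV}; case: s => // h s; rewrite !inE.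
  case: (eqVneq y h) => [yh _|_ /= ys _]; last first.
    by exists y; rewrite -?nb ?inE ?eqxx.
  by rewrite -yh eq_sym (negPf yz) /= => zs; exists z; rewrite -?nb ?inE ?eqxx ?orbT.
case: s sw Us ps {ltn ltV sub} => // h s; rewrite [behead _]/=.
case/splitPr=> a b Us /= /andP[xh]; rewrite cat_path => /andP[pa /= /andP[aw _]].
exists [:: x, h & rcons a w]; split.
- by move: Us; rewrite -cat_rcons -!cat_cons cat_uniq => /andP[].
- by rewrite /= xh !rcons_path pa aw last_rcons adj_sym.
- by rewrite /= size_rcons.
Qed.

(** A cycle in the graph already contains both neighbours of each of its vertices, so it is closed
    under adjacency and covers [V]. *)
Lemma two_regular_is_cycle : 0 < #|V| -> connected G ->
  (forall v, #|[set u | adj G v u]| = 2) -> is_cycle #|V| G.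
Proof.
move=> /card_gt0P[x0 _] conn deg2.
have [||s [Us cs s3]] := @path_to_cycle x0 [::] deg2; rewrite // .
have nbrs x : x \in s -> [set u | adj G x u] = [set next s x; prev s x].
  move=> sx; apply/esym/eqP; rewrite eqEcard deg2 cards2 next_neq_prev // andbT.
  apply/subsetP=> u; rewrite !inE => /orP[]/eqP->; first exact: next_cycle.
  by rewrite adj_sym; apply: prev_cycle.
have all_s : s =i predT.
  move=> v; rewrite [RHS]inE.
  have [x sx] : exists x, x \in s by case: (s) s3 => // x s' _; exists x; rewrite mem_head.
  have clS : closed (adj G) s.
    apply: intro_closed => [|u w uw su]; first exact: sym_connect_sym adj_sym.
    have : w \in [set u' | adj G u u'] by rewrite inE.
    by rewrite nbrs // !inE => /orP[]/eqP->; rewrite ?mem_next ?mem_prev.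
  by rewrite -(closed_connect clS (forallP (forallP conn x) v)).
exists s; split=> //.
- by rewrite -(card_uniqP Us); apply: eq_card.
- rewrite -(_ : size s = #|V|) //.
  by rewrite -(card_uniqP Us); apply: eq_card.
- move=> x y; have : (y \in [set u | adj G x u]) = adj G x y by rewrite inE.
  rewrite nbrs ?all_s // !inE => <-; congr (_ || _).
  by apply/eqP/eqP=> ->; rewrite ?next_prev ?prev_next.
Qed.

Lemma is_cycle_two_regular n : is_cycle n G -> forall v, #|[set u | adj G v u]| = 2.
Proof.
case=> s [Us <- s3 all_s E] v.
have -> : [set u | adj G v u] = [set next s v; prev s v].
  apply/setP=> u; rewrite !inE E; congr (_ || _).
  by apply/eqP/eqP=> ->; rewrite ?next_prev ?prev_next.
by rewrite cards2 next_neq_prev ?all_s.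
Qed.

Lemma sum_wt_regular c v (E : forall u, adj G v u -> wt G v u = c) :
  \sum_u wt G v u = #|[set u | adj G v u]| * c.
Proof.
rewrite -sum_nat_const (bigID (adj G v)) /= [X in _ + X]big1 ?addn0 => [|u].
  by apply: eq_big => u; [rewrite inE | apply: E].
by rewrite -eqn0Ngt => /eqP.
Qed.

End Cycles.

(** * Weights and degrees read off the quotient cycle *)

Section Quotient.
Variables (V : finType) (G : mgraph V) (M : {set V}) (c n : nat).
Hypothesis cyc : c_cycle c n (contract G M).

Let class_Some (b : {x | x \notin M}) x : (contract_class M x == Some b) = (x == val b).
Proof.
rewrite /contract_class; case: insubP => [u _ <-|].
  by rewrite (inj_eq Some_inj).
by rewrite negbK => Mx; apply/esym; apply: contraTF Mx => /eqP->; apply: valP b.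
Qed.

Let class_None x : (contract_class M x == None) = (x \in M).
Proof. by rewrite /contract_class; case: insubP => [u /negPf-> _|]; rewrite ?negbK. Qed.

Let wt_None b : wt (contract G M) None (Some b) = wdeg G M (val b).
Proof.
rewrite /= /contract_wt (eq_bigl _ _ class_None); apply: eq_bigr => x _.
by rewrite (eq_bigl _ _ (class_Some b)) big_pred1_eq.
Qed.

Let wt_Some b b' : wt (contract G M) (Some b) (Some b') = wt G (val b) (val b').
Proof.
rewrite /= /contract_wt (inj_eq Some_inj) -val_eqE.
case: eqVneq => [->|_]; first by rewrite wt_loopless.
by rewrite (eq_bigl _ _ (class_Some b)) big_pred1_eq (eq_bigl _ _ (class_Some b')) big_pred1_eq.
Qed.

Let wt0c C D : wt (contract G M) C D \in [:: 0; c].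
Proof.
rewrite !inE; case: (posnP (wt _ C D)) => // CD.
by apply/eqP; case: cyc => _; apply.
Qed.

Lemma quotient_wt b b' : b \notin M -> b' \notin M -> wt G b b' \in [:: 0; c].
Proof. by move=> Mb Mb'; have := wt0c (Some (Sub b Mb)) (Some (Sub b' Mb')); rewrite wt_Some. Qed.

Lemma quotient_wdeg b : b \notin M -> wdeg G M b \in [:: 0; c].
Proof. by move=> Mb; have := wt0c None (Some (Sub b Mb)); rewrite wt_None. Qed.

Let sum_quotient (F : option {x | x \notin M} -> nat) (f : V -> nat) :
  (forall b, F (Some b) = f (val b)) ->
  \sum_C F C = F None + \sum_(v | v \notin M) f v.
Proof.
move=> Ff; rewrite (bigD1 None) //=; congr (_ + _).
rewrite (reindex_omap Some id) => [|[]//].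
rewrite [RHS](reindex_omap (val : {x | x \notin M} -> V) insub) => [|v Mv]; last by rewrite insubT.
by apply: eq_big => [b|b _]; rewrite ?Ff // (valP b : val b \notin M) valK !eqxx.
Qed.

Let deg_quotient C : \sum_D wt (contract G M) C D = 2 * c.
Proof.
case: cyc => cy E; rewrite (sum_wt_regular (c := c)) ?(is_cycle_two_regular cy) //.
by move=> D; apply: E.
Qed.

Lemma quotient_root : \sum_(b | b \notin M) wdeg G M b = 2 * c.
Proof.
by rewrite -(deg_quotient None) (sum_quotient wt_None) wt_loopless.
Qed.

Lemma quotient_deg b : b \notin M -> \sum_v wt G v b = 2 * c.
Proof.
move=> Mb; pose C : option {x | x \notin M} := Some (Sub b Mb).
rewrite -(deg_quotient C) (sum_quotient (wt_Some _)) wt_sym wt_None /=.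
rewrite (bigID (mem M)) /=; congr (_ + _).
by apply: eq_bigr => v _; rewrite wt_sym.
Qed.

Lemma quotient_card : #|~: M|.+1 = n.
Proof.
have [[s [Us <- _ all_s _]] _] := cyc.
by rewrite -(card_uniqP Us) (eq_card all_s) card_option card_sig cardsE.
Qed.

End Quotient.

(** * Symmetry of parking functions *)

Section Swaps.
Variables (V : finType) (G : mgraph V) (r : V) (A : {set V}).
Hypothesis rA : r \notin A.
Hypothesis linkV : linked G setT.

Lemma ordering_extend W s : linked G W -> burning G r s -> {subset s <= W} ->
  exists t, ordering G r W (s ++ t).
Proof. by move=> linkW bs sW; have [t []] := burning_extend linkW bs sW; exists t. Qed.

Lemma tperm_root i j v : i \in A -> j \in A -> v != r -> tperm i j v != r.
Proof.
by move=> Ai Aj vr; case: tpermP => // _; [apply: contraNneq rA => <- | apply: contraNneq rA => <-].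
Qed.

(* Extend the ordering of W to V, swap there, and delete the vertices outside W:
   this can only lower the values on W, whose sum is the number of edges in W. *)
Lemma swappable_sub (W : {set V}) : r \in W -> A \subset W -> linked G W ->
  swappable G r A setT -> swappable G r A W.
Proof.
move=> Wr /subsetP AW linkW swapV s i j os Ai Aj; have [bs sW] := os.
have [|t ot] := ordering_extend linkV bs; first by move=> v _; rewrite inE.
have [u [[Uu ru posu] uV] Eu] := swapV _ i j ot Ai Aj.
pose s' := filter (mem W) u.
have Us' : uniq s' by rewrite filter_uniq.
have s'W : s' =i W by move=> v; rewrite mem_filter uV !inE andbT.
have tW v : (tperm i j v \in W) = (v \in W) by rewrite perm_on_tperm // AW.
have Euv v : v \in W -> indeg G u v = indeg G s (tperm i j v).
  by move=> Wv; rewrite Eu ?inE // indeg_catl // sW tW.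
have leW v : v \in W -> indeg G s' v <= indeg G s (tperm i j v).
  by move=> Wv; rewrite -Euv // indeg_filter.
have sumW : \sum_(v in W) indeg G s' v = \sum_(v in W) indeg G s (tperm i j v).
  have -> : \sum_(v in W) indeg G s (tperm i j v) = \sum_(v in W) indeg G s v.
    by rewrite [RHS](reindex_inj (@perm_inj _ (tperm i j))); apply: eq_bigl.
  apply/eqP; rewrite -(eqn_pmul2l (isT : 0 < 2)) !(sum_indeg_set G _ (W := W)) //.
  by case: bs.
have Es' := eq_sum_of_leq leW sumW.
exists s' => //; split=> //; split=> // [|v]; first by rewrite s'W.
rewrite s'W => Wv vr; rewrite Es' //; have [_ _ pos] := bs.
by apply: pos; rewrite ?sW ?tW ?tperm_root.
Qed.

(* Burning i last gives it the value wdeg i, which a swap moves to j. *)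
Lemma wdeg_le i j : swappable G r A setT -> linked G [set~ i] -> i \in A -> j \in A ->
  wdeg G setT i <= wdeg G setT j.
Proof.
move=> swapV linki Ai Aj.
have ir : i != r by apply: contraNneq rA => <-.
have [|t [bt tV]] := ordering_extend linki (burning1 G r).
  by move=> v; rewrite !inE => /eqP->; rewrite eq_sym.
set s := _ ++ t in bt tV.
have si : i \notin s by rewrite tV !inE eqxx.
have Ei : wdeg G setT i = \sum_(u <- s) wt G u i.
  rewrite big_uniq; last by case: bt.
  rewrite /wdeg [LHS](bigD1 i) ?inE //= wt_loopless; apply: eq_bigl => u.
  by rewrite tV !inE.
have [||u [v [Su]]] := linkV (S := [set~ i]).
- by apply/set0Pn; exists r; rewrite !inE eq_sym.
- by apply/properP; split; [apply/subsetP=> v; rewrite inE | exists i; rewrite !inE ?eqxx].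
rewrite !inE andbT negbK => /eqP-> ui.
have gt0 : 0 < \sum_(u <- s) wt G u i.
  by rewrite -Ei /wdeg (bigD1 u) ?inE //= addn_gt0 ui.
have os : ordering G r setT (rcons s i).
  split; first exact: burning_rcons.
  by move=> w; rewrite mem_rcons inE tV !inE; case: eqVneq.
have [s' [[Us' _ _] s'V] Es'] := swapV _ i j os Ai Aj.
rewrite Ei -(indeg_rcons G si) -{2}(tpermR i j) -Es' ?inE //.
by apply: indeg_le_sum => // w; rewrite inE.
Qed.

Lemma dvdn_indeg c s v : (forall u, c %| wt G u v) -> c %| indeg G s v.
Proof.
move=> cv; elim: s => //= u s IHs; case: eqP => // _; exact: dvdn_add.
Qed.

(* Burn M up to the first neighbour x of b and then b, so that the indegree of
   b is wt x b.  Exchanging b with b' makes this an indegree of b'. *)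
Lemma swap_wt_dvd c M b b' u : swappable G r A setT -> linked G M -> r \in M ->
  b \in A -> b' \in A -> b \notin M -> wdeg G M b = c ->
  (forall v, c %| wt G v b') -> u \in M -> wt G u b \in [:: 0; c].
Proof.
move=> swapV linkM Mr Ab Ab' Mb degb dvd' Mu; rewrite !inE.
have [//|ub] := posnP (wt G u b) => /=.
have [|t ot] := ordering_extend linkM (burning1 G r).
  by move=> v; rewrite !inE => /eqP->.
set s := _ ++ t in ot; have [bs sM] := ot.
have [x [s1 [s2 [Es xb s1b]]]] : exists x s1 s2,
    [/\ s = rcons s1 x ++ s2, 0 < wt G x b & ~~ has (fun y => 0 < wt G y b) s1].
  have : has (fun x => 0 < wt G x b) s by apply/hasP; exists u; rewrite ?sM.
  by case/split_find => x s1 s2; exists x, s1, s2.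
have b1 : burning G r (rcons s1 x).
  by apply: (@burning_prefix _ _ _ _ s2); rewrite -?Es //; case: (s1).
have b_s1 : b \notin rcons s1 x.
  by apply: contra Mb => bs1; rewrite -sM Es mem_cat bs1.
have sum1 : \sum_(y <- rcons s1 x) wt G y b = wt G x b.
  rewrite -cats1 big_cat big_seq1 /= big1_seq // => y /andP[_ ys1].
  by apply/eqP; rewrite -leqn0 leqNgt; apply: (hasPn s1b).
have [||t' ot'] := ordering_extend linkV (burning_rcons b1 b_s1 _).
- by rewrite sum1.
- by move=> v _; rewrite inE.
have [s' _ Es'] := swapV _ b b' ot' Ab Ab'.
(* The swapped value is an indegree of [b'], a sum of multiples of [c]. Being positive and at most
   [wdeg G M b = c], the weight is [c], and [x] is the only neighbour of [b] in [M]. *)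
have dvdx : c %| wt G x b.
  have := dvdn_indeg s' dvd'; rewrite Es' ?inE // tpermR.
  by rewrite indeg_catl ?mem_rcons ?mem_head // indeg_rcons // sum1.
have Mx : x \in M by rewrite -sM Es mem_cat mem_rcons mem_head.
have cx := dvdn_leq xb dvdx; have := degb; rewrite /wdeg (bigD1 x) //=.
case: (eqVneq u x) => [->|ux]; first by move=> *; apply/eqP; lia.
by rewrite (bigD1 u) /= ?Mu //; lia.
Qed.

End Swaps.

(** * Parking functions and burning orders *)

Section ParkingOrders.
Variables (p q : nat) (G : mgraph 'I_(p + q).+1).
Hypotheses (connG : connected G) (typeG : typeI G).

(** The first vertex of [U] in the order receives its indegree from outside [U]; the predecessor
    makes the inequality strict. *)
Lemma parking_of_ordering s : ordering G ord0 setT s ->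
  parking G (fun k => (indeg G s (lift ord0 k)).-1).
Proof.
case=> [[Us _ pos] sV] U /set0Pn[v Uv] U0.
have [x [s1 [s2 [Es Ux U1]]]] : exists x s1 s2,
    [/\ s = rcons s1 x ++ s2, x \in U & ~~ has (mem U) s1].
  have : has (mem U) s by apply/hasP; exists v; rewrite ?sV ?inE.
  by case/split_find => x s1 s2; exists x, s1, s2.
have x0 : x != ord0 by apply: contraNneq U0 => <-.
have /andP[xs1 Us1] : (x \notin s1) && uniq s1.
  by move: Us; rewrite Es cat_uniq rcons_uniq => /andP[].
have Ex : indeg G s x = \sum_(w <- s1) wt G w x.
  by rewrite Es indeg_catl ?mem_rcons ?mem_head // indeg_rcons.
have ltx : (indeg G s x).-1 < outdeg G U x.
  rewrite prednK ?pos ?sV ?inE // Ex.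
  have sub1 : {subset s1 <= ~: U} by move=> w sw; rewrite inE; apply: (hasPn U1).
  apply: (leq_trans (leq_sum_seq_set (wt G ^~ x) Us1 sub1)); apply: eq_leq.
  by apply: eq_big => [w|w _]; [rewrite inE | exact: wt_sym].
case: (unliftP ord0 x) x0 ltx Ux => [k -> _ ltk Uk|->]; last by rewrite eqxx.
by exists k.
Qed.

(** Dhar's burning algorithm: the parking condition on the unburnt set yields the next vertex to
    burn. *)
Lemma ordering_of_parking b : parking G b ->
  exists2 s, ordering G ord0 setT s & forall k, b k < indeg G s (lift ord0 k).
Proof.
move=> parkb.
pose g v := if unlift ord0 v is Some k then (b k).+1 else 0.
have [|||t [Ut tW gt]] := @greedy_order _ G g setT [:: ord0] ord0 isT (mem_head _ _).
- by move=> i _; rewrite inE.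
- by move=> i; rewrite inE => /eqP->; rewrite /g unlift_none.
- move=> S S0 /properP[_ [v _ Sv]].
  have [||k [Sk bk]] := parkb (~: S).
  + by apply/set0Pn; exists v; rewrite inE.
  + by rewrite inE S0.
  exists (lift ord0 k); first by move: Sk; rewrite !inE andbT.
  rewrite /g liftK; congr (_ < _): bk; apply: eq_big => [u|u _]; first by rewrite inE negbK.
  exact: wt_sym.
exists ([:: ord0] ++ t) => [|k]; last first.
  by have := gt (lift ord0 k); rewrite tW inE /g liftK => /(_ isT).
split=> //; split=> // v /gt; rewrite /g.
by case: unliftP => [k -> /(leq_trans _)-> //|-> _]; rewrite eqxx.
Qed.

Lemma parking_tperm (i j : 'I_(p + q)) b : (i < p) = (j < p) ->
  parking G b -> parking G (fun k => b (tperm i j k)).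
Proof.
move=> ij parkb; have [_ _ _ inv] := typeG.
have [s [t E]] : exists (s : 'S_p) (t : 'S_q), block_perm s t =1 tperm i j.
  move: ij; case: (split_ordP i) => i' ->; case: (split_ordP j) => j' ->.
  - move=> _; exists (tperm i' j'), 1%g => k; rewrite /block_perm.
    case: (split_ordP k) => k' ->; last by rewrite perm1 tpermD ?eq_lrshift.
    by rewrite inj_tperm //; apply: lshift_inj.
  - by rewrite /=; have := ltn_ord i'; lia.
  - by rewrite /=; have := ltn_ord j'; lia.
  move=> _; exists 1%g, (tperm i' j') => k; rewrite /block_perm.
  case: (split_ordP k) => k' ->; first by rewrite perm1 tpermD ?eq_rlshift.
  by rewrite inj_tperm //; apply: rshift_inj.
have /(inv s t b) := parkb.
by move=> H U U0 Uz; have [k []] := H U U0 Uz; exists k; rewrite -E.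
Qed.

(** The swapped values minus one form a parking function, hence are dominated by the indegrees of
    some ordering. Both families of values sum to the number of edges, so they agree. *)
Lemma swappable_parking (C : {set 'I_(p + q).+1}) :
  (C \subset Aset p q) || (C \subset Bset p q) -> swappable G ord0 C setT.
Proof.
move=> subC s i j os Ci Cj.
have nonroot v : v \in C -> exists k, v = lift ord0 k.
  move=> Cv; case: (unliftP ord0 v) => [k ->|v0]; first by exists k.
  by case/orP: subC => /subsetP/(_ v Cv); rewrite v0 inE //= addn1.
have [i' Ei] := nonroot i Ci; have [j' Ej] := nonroot j Cj.
have ij : (i' < p) = (j' < p).
  case/orP: subC => /subsetP sC; have := sC i Ci; have := sC j Cj;
    rewrite Ei Ej !inE !lift0 ?addn1 ?ltnS => /andP[] + + /andP[].
    by move=> _ -> _ ->.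
  by rewrite [in RHS]ltnNge [in LHS]ltnNge => -> _ -> _.
have [s' os' lt'] := ordering_of_parking (parking_tperm ij (parking_of_ordering os)).
exists s' => // v0 _; pose tau := tperm i j.
have tau_lift k : tau (lift ord0 k) = lift ord0 (tperm i' j' k).
  by rewrite /tau Ei Ej inj_tperm //; apply: lift_inj.
have tau0 : tau ord0 = ord0.
  by rewrite /tau Ei Ej tpermD // eq_sym neq_lift.
have le' v : v \in setT -> indeg G s (tau v) <= indeg G s' v.
  move=> _; case: (unliftP ord0 v) => [k ->|->].
    by rewrite tau_lift; exact: leq_trans (leqSpred _) (lt' k).
  by rewrite tau0 (burning_root os.1).
rewrite (eq_sum_of_leq le') ?inE //.
have -> : \sum_(v in setT) indeg G s (tau v) = \sum_(v in setT) indeg G s v.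
  by rewrite [RHS](reindex_inj (@perm_inj _ tau)); apply: eq_bigl => v; rewrite !inE.
have [[Us _ _] sV] := os; have [[Us' _ _] sV'] := os'.
by apply/eqP; rewrite -(eqn_pmul2l (isT : 0 < 2)) !(sum_indeg_set G _ (W := setT)).
Qed.

End ParkingOrders.

(** * Classification *)

Section Classification.
Variables (V : finType) (G : mgraph V) (r : V) (A : {set V}) (c n : nat).
Local Notation M := (r |: A).
Hypotheses (rA : r \notin A) (A_gt0 : 0 < #|A|) (c_gt0 : 0 < c).
Hypotheses (linkV : linked G setT) (linkM : linked G M).
Hypothesis linkC : forall v, linked G [set~ v].
Hypothesis swapA : swappable G r A setT.
Hypothesis swapB : swappable G r (~: M) setT.
Hypothesis cyc : c_cycle c n (contract G M).
Hypothesis attach :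
  (forall b, b \notin M -> #|[set u in M | adj G b u]| = 1) \/ 4 <= n.

(** With one neighbour in [M], that weight is the whole quotient weight, 0 or [c]. On a longer cycle
    some [b'] outside [M] has no neighbour in [M], so all weights at [b'] are multiples of [c] and
    [swap_wt_dvd] applies. *)
Lemma wt_outside b u : b \notin M -> wt G u b \in [:: 0; c].
Proof.
move=> Mb; case Mu: (u \in M); last by rewrite (quotient_wt cyc) // Mu.
case: attach => [/(_ b Mb)/eqP/cards1P[x Ex]|n4].
  have nbx v : v \in M -> v != x -> wt G v b = 0.
    move=> Mv vx; apply/eqP; rewrite -leqn0 leqNgt wt_sym; apply: contra vx => bv.
    by rewrite -in_set1 -Ex !inE /adj bv -in_setU1 Mv.
  case: (eqVneq u x) => [->|ux]; last by rewrite nbx // inE eqxx.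
  have Mx : x \in M by have := set11 x; rewrite -Ex inE => /andP[].
  have := quotient_wdeg cyc Mb; rewrite /wdeg (bigD1 x) //= big1 ?addn0 // => v /andP[].
  exact: nbx.
have := quotient_wdeg cyc Mb; rewrite !inE => /orP[/eqP w0|/eqP wc].
  by move: w0 => /eqP; rewrite /wdeg sum_nat_eq0 => /forall_inP/(_ u Mu)->.
(* Otherwise the root degree [2 * c] of the quotient gives two vertices outside [M], a cycle of
   length three. *)
have [b' Mb' w0] : exists2 b', b' \notin M & wdeg G M b' != c.
  apply/exists_inP; rewrite -negb_forall_in; apply/negP=> /forall_inP allc.
  have := quotient_root cyc; rewrite (eq_bigr (fun=> c)) => [|v Mv]; last exact/eqP/allc.
  rewrite -(eq_bigl _ _ (fun v => in_setC v M)) sum_nat_const => /eqP.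
  rewrite eqn_pmul2r // => /eqP card2.
  by move: n4; rewrite -(quotient_card cyc) card2.
have {}w0 : wdeg G M b' = 0.
  by have := quotient_wdeg cyc Mb'; rewrite !inE (negPf w0) orbF => /eqP.
have dvd' v : c %| wt G v b'.
  case Mv: (v \in M).
    by move/eqP: w0; rewrite /wdeg sum_nat_eq0 => /forall_inP/(_ v Mv)/eqP->; apply: dvdn0.
  have := quotient_wt cyc (negbT Mv) Mb'; rewrite !inE => /orP[]/eqP-> //.
have rB : r \notin ~: M by rewrite in_setC setU11.
suff: wt G u b \in [:: 0; c] by rewrite !inE.
by apply: (swap_wt_dvd rB linkV swapB linkM (setU11 _ _) _ _ Mb wc dvd' Mu); rewrite in_setC.
Qed.

Let e u := \sum_(b | b \notin M) wt G u b.

Let T := [set u in M | 0 < e u].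

Lemma sum_e : \sum_(u in M) e u = 2 * c.
Proof. by rewrite exchange_big -(quotient_root cyc). Qed.

(** The multiple [e u] of [c] is at most [2 * c]. Equality would leave [u] as the only vertex of [M]
    with neighbours outside [M], hence a cut vertex. *)
Lemma e_val u : u \in M -> e u = c * (u \in T).
Proof.
move=> Mu; rewrite inE Mu /=; have [->|eu] := posnP (e u); first by rewrite muln0.
have /dvdnP[k Ek] : c %| e u.
  by apply: dvdn_sum => b /(wt_outside u); rewrite !inE => /orP[]/eqP->.
have rest : e u + \sum_(v in M | v != u) e v = 2 * c by rewrite -sum_e [RHS](bigD1 u).
have [||v [w [Sv]]] := linkC (v := u) (S := M :\ u).
- have [x Ax] := card_gt0P A_gt0; case: (eqVneq u r) => [ur|ur].
    apply/set0Pn; exists x; rewrite !inE Ax orbT andbT ur.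
    by apply: contraNneq rA => <-.
  by apply/set0Pn; exists r; rewrite !inE eqxx eq_sym ur.
- apply/properP; split; first by apply/subsetP=> v; rewrite !inE => /andP[].
  have : 0 < e u by [].
  rewrite lt0n sum_nat_eq0 negb_forall => /existsP[b]; rewrite negb_imply => /andP[Mb _].
  exists b; last by rewrite in_setD1 (negPf Mb) andbF.
  by rewrite !inE; apply: contraNneq Mb => ->.
move: Sv; rewrite !in_setD1 !inE => /andP[vu Mv] /andP[+ wu]; rewrite wu /= => Mw vw.
have ev : 0 < \sum_(v in M | v != u) e v.
  rewrite (bigD1 v) /= ?inE ?Mv // addn_gt0 {1}/e (bigD1 w) /= ?addn_gt0 ?vw //.
  by rewrite !inE.
have k_lt : k < 2 by rewrite -(ltn_pmul2r c_gt0) -Ek; lia.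
by case: k Ek k_lt => [|[|//]] Ek _; rewrite Ek ?mul1n ?muln1 // in eu *.
Qed.

Lemma card_T : #|T| = 2.
Proof.
apply/eqP; rewrite -(eqn_pmul2r c_gt0) -sum_e -sum_nat_const big_mkcond [eqbRHS]big_mkcond.
apply/eqP/eq_bigr => u _; case Mu: (u \in M); last by rewrite inE Mu.
by rewrite e_val //; case: (u \in T); rewrite ?muln1 ?muln0.
Qed.

Lemma T_sub : T \subset M.
Proof. by apply/subsetP=> u; rewrite inE => /andP[]. Qed.

Lemma wdeg_split u : u \in M -> wdeg G M u + c * (u \in T) = wdeg G setT u.
Proof.
move=> Mu; rewrite -e_val // [RHS](bigID (mem M)) /=; congr (_ + _).
  by apply: eq_bigl => v; rewrite in_setT.
by apply: eq_big => [v|v _]; [rewrite in_setT | exact: wt_sym].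
Qed.

Lemma c_cycle_of_degrees : connected G ->
  (forall u v, u \in M -> v \in M -> wt G u v \in [:: 0; c]) ->
  (forall u, u \in M -> wdeg G setT u = 2 * c) -> c_cycle c #|V| G.
Proof.
move=> conn wtM degM.
have wt0c u v : wt G u v \in [:: 0; c].
  case Mv: (v \in M); last by rewrite wt_outside ?Mv.
  case Mu: (u \in M); last by rewrite wt_sym wt_outside ?Mu.
  exact: wtM.
have adjc u v : adj G u v -> wt G u v = c.
  by move=> uv; have := wt0c u v; rewrite !inE => /orP[/eqP E|/eqP//]; rewrite /adj E in uv.
split=> //; apply: two_regular_is_cycle => // [|v]; first by apply/card_gt0P; exists r.
apply/eqP; rewrite -(eqn_pmul2r c_gt0) -(sum_wt_regular (@adjc v)); apply/eqP.
have -> : \sum_u wt G v u = wdeg G setT v.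
  by apply: eq_big => [u|u _]; [rewrite inE | exact: wt_sym].
case Mv: (v \in M); first exact: degM.
by rewrite -(quotient_deg cyc (negbT Mv)); apply: eq_bigl => u; rewrite inE.
Qed.

Lemma classification : connected G ->
  [\/ c_cycle c #|V| G, #|A| = 1 |
      #|A| = 2 /\ forall u v, u \in A -> v \in A -> wt G r u = wt G r v].
Proof.
move=> conn; have [a Aa] := card_gt0P A_gt0.
have nonroot_mem v : v \in A -> v \in M by rewrite !inE orbC => ->.
have degM v : v \in A -> wdeg G M v + c * (v \in T) = wdeg G setT a.
  move=> Av; rewrite wdeg_split ?nonroot_mem //; apply/eqP.
  by rewrite eqn_leq !(wdeg_le rA linkV swapA).
have swapM : swappable G r A M.
  apply: swappable_sub => //; [exact: setU11 | exact: subsetUr].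
have [A1|A2] : #|A| = 1 \/ 2 <= #|A| by lia.
  by constructor 2.
have finish : saturated G r A c (wdeg G setT a) -> ~~ (A \subset T) -> c_cycle c #|V| G.
  move=> sat /subsetPn AT.
  have [|d2 degr] := saturated_balance rA linkM swapM T_sub card_T c_gt0 degM sat AT.
    (* All neighbours of [r] lie in [A]; after deletion of one of them, [r] still has another, as
       there is no cut vertex. *)
    move=> Tr; have er : e r = 0 by rewrite e_val ?setU11 // (negPf Tr) muln0.
    have nbr w : 0 < wt G r w -> w \in A.
      move=> rw; case Mw: (w \in M).
        by rewrite (mem_nonroot rA) //; apply: contraTneq rw => ->; rewrite wt_loopless.
      by move: rw; move/eqP: er; rewrite sum_nat_eq0 => /forall_inP/(_ w (negbT Mw))/eqP->.
    have neq_r w : w \in A -> w != r by apply: contraTneq => ->.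
    have [||_ [u [/set1P-> _ ru]]] := linkV (S := [set r]).
    - by apply/set0Pn; exists r; rewrite inE.
    - by apply/properP; rewrite subsetT; split=> //; exists a; rewrite !inE ?neq_r.
    have Au := nbr u ru; have [x] : exists x, x \in A :\ u.
      by apply/card_gt0P; have := cardsD1 u A; rewrite Au; lia.
    rewrite !inE => /andP[xu Ax].
    have [||_ [v [/set1P-> + rv]]] := linkC (v := u) (S := [set r]).
    - by apply/set0Pn; exists r; rewrite inE.
    - apply/properP; rewrite sub1set !inE eq_sym neq_r //; split=> //.
      by exists x; rewrite !inE ?neq_r.
    by rewrite !inE => /andP[_ vu]; exists u, v; rewrite eq_sym vu Au nbr.
  apply: c_cycle_of_degrees => // [u v Mu Mv|u Mu].
    have [->|] := saturated_wt rA linkM sat Mu Mv.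
      by rewrite inE eqxx.
    by rewrite d2 mul2n -addnn => /addIn->; rewrite !inE eqxx orbT.
  rewrite -d2; case: (eqVneq u r) => [->|ur]; first by rewrite -wdeg_split ?setU11.
  by rewrite -(degM u) ?wdeg_split // (mem_nonroot rA).
case Tr: (r \in T); last first.
  have TA : T \subset A.
    apply/subsetP=> u Tu; have := subsetP T_sub u Tu; rewrite !inE => /orP[/eqP ur|//].
    by rewrite -ur Tu in Tr.
  have [A3|A_eq2] : 2 < #|A| \/ #|A| = 2 by lia.
    constructor 1; apply: finish.
      exact: (saturated_avoiding rA linkM swapM T_sub card_T c_gt0 degM).
    by apply: contraL A3 => /subset_leq_card; rewrite card_T -leqNgt.
  constructor 3; split=> // u v Au Av; case: (eqVneq u v) => [->//|uv].
  have EA : A = [set u; v].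
    apply/esym/eqP; rewrite eqEcard cards2 uv A_eq2 andbT.
    by apply/subsetP=> w; rewrite !inE => /orP[]/eqP->.
  (* Thus [u] and [v] have equal degrees in [M], and cancelling [wt G u v] leaves their weights to
     the root. *)
  have AT : A = T by apply/esym/eqP; rewrite eqEcard TA card_T A_eq2.
  have := degM u Au; rewrite -(degM v Av) -AT Au Av => /addIn.
  have ru : r \notin [set u; v] by rewrite -EA.
  have uNv : u \notin [set v] by rewrite inE.
  rewrite /wdeg EA !(big_setU1 _ ru) !(big_setU1 _ uNv) /= !big_set1 !wt_loopless.
  by rewrite addn0 add0n [wt G v u]wt_sym => /addIn.
constructor 1; apply: finish.
  exact: (saturated_root rA swapM T_sub card_T c_gt0 degM Tr).
(* As [r] is in [T], only one other vertex is, while [A] has at least two. *)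
apply/negP=> AT; have : A \subset T :\ r.
  apply/subsetP=> u Au; rewrite in_setD1 (subsetP AT) // andbT.
  by apply: contraNneq rA => <-.
by move/subset_leq_card; have := cardsD1 r T; rewrite Tr card_T; lia.
Qed.

End Classification.

(** * Translation to the numbered vertices *)

Lemma root_notin_Aset p q : ord0 \notin Aset p q.
Proof. by rewrite inE. Qed.

Lemma Bset_setC p q : Bset p q = ~: (ord0 |: Aset p q).
Proof.
apply/setP=> i; rewrite !inE -val_eqE /= negb_or.
have := ltn_ord i; case: (nat_of_ord i) => [|k]; first by rewrite addn1.
by rewrite ltnS addn1 /= -ltnNge => ->; rewrite andbT.
Qed.

Lemma card_Aset p q : #|Aset p q| = p.
Proof.
have -> : Aset p q = [set lift ord0 (lshift q i) | i : 'I_p].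
  apply/setP=> i; rewrite inE; apply/idP/imsetP => [/andP[i0 ip]|[k _ ->]].
    case: (unliftP ord0 i) i0 ip => [j ->|->//] _; rewrite lift0 => jp.
    by exists (Ordinal jp) => //; congr (lift _ _); apply: val_inj.
  by rewrite lift0; apply: (ltn_ord k).
by rewrite card_imset ?card_ord // => i j /lift_inj/lshift_inj.
Qed.

Theorem theorem6p11 (p q : nat) (G : mgraph 'I_(p + q).+1) (c : nat)
    (Gconn : connected G) (GtypeI : typeI G)
    (Gnocut : forall v, ~~ cut_vertex G v)
    (c_gt0 : 0 < c)
    (Gquo :
      (c_cycle c 3 (contract G (ord0 |: Aset p q)) /\
       (forall j, j \in Bset p q ->
          #|[set i in ord0 |: Aset p q | adj G j i]| = 1))
      \/
      (exists n, 4 <= n /\ c_cycle c n (contract G (ord0 |: Aset p q)))) :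
  exists a b : nat, 0 < a /\ 0 < b /\
    let v0 : 'I_(p + q).+1 := ord0 in
    let v1 : 'I_(p + q).+1 := inord 1 in
    let v2 : 'I_(p + q).+1 := inord 2 in
    [\/ exists n, c_cycle c n G,
        [/\ Aset p q = [set v1],
            wt G v0 v1 = a &
            forall i j, adj G i j -> [set i; j] != [set v0; v1] ->
              wt G i j = c] |
        [/\ Aset p q = [set v1; v2],
            wt G v0 v1 = a, wt G v0 v2 = a,
            adj G v1 v2 -> wt G v1 v2 = b &
            forall i j, adj G i j ->
              [set i; j] \notin
                [:: [set v0; v1]; [set v0; v2]; [set v1; v2]] ->
              wt G i j = c]].
Proof.
have [p_gt0 _ connM _] := GtypeI.
have rA := root_notin_Aset p q.
have A_gt0 : 0 < #|Aset p q| by rewrite card_Aset.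
have linkV := connected_linked Gconn.
have linkM := induced_linked connM.
have linkC v : linked G [set~ v].
  by apply: induced_linked; have := Gnocut v; rewrite /cut_vertex negbK.
have swapA : swappable G ord0 (Aset p q) setT.
  by apply: swappable_parking => //; rewrite subxx.
have swapB : swappable G ord0 (~: (ord0 |: Aset p q)) setT.
  by apply: swappable_parking => //; rewrite -Bset_setC subxx orbT.
have [n [cyc attach]] : exists n, c_cycle c n (contract G (ord0 |: Aset p q)) /\
    ((forall b, b \notin ord0 |: Aset p q ->
        #|[set u in ord0 |: Aset p q | adj G b u]| = 1) \/ 4 <= n).
  case: Gquo => [[cyc one]|[n [n4 cyc]]]; last by exists n; split; [|right].
  by exists 3; split=> //; left=> b Mb; apply: one; rewrite Bset_setC inE.
have outside i j : adj G i j ->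
    (i \notin ord0 |: Aset p q) || (j \notin ord0 |: Aset p q) -> wt G i j = c.
  have wt_out := wt_outside c_gt0 linkV linkM swapB cyc attach.
  rewrite /adj => ij out; have : wt G i j \in [:: 0; c].
    by case/orP: out => out; [rewrite wt_sym|]; apply: wt_out.
  by rewrite !inE => /orP[/eqP E|/eqP//]; rewrite E in ij.
(* The weight [wt G ord0 v] serves as [a]; connectedness of the root side makes it positive. *)
have [v Av rv] : exists2 v, v \in Aset p q & 0 < wt G ord0 v.
  have [x Ax] := card_gt0P A_gt0.
  have [||_ [v [/set1P-> Mv rv]]] := linkM [set ord0].
  - by apply/set0Pn; exists ord0; rewrite inE.
  - apply/properP; rewrite sub1set setU11; split=> //; exists x.
      by rewrite in_setU1 Ax orbT.
    by rewrite inE; apply: contraNneq rA => <-.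
  by exists v => //; move: Mv; rewrite !in_setD in_set1 in_setU1; case: (v == ord0).
have [cycG|A1|[A2 eq_wt]] := classification rA A_gt0 c_gt0 linkV linkM linkC swapA swapB cyc attach Gconn.
- by exists 1, 1; do 2!split=> //; constructor 1; exists #|'I_(p + q).+1|.
- have p1 : p = 1 by rewrite -(card_Aset p q).
  have EA : Aset p q = [set inord 1].
    apply/setP=> i; rewrite !inE -val_eqE /= inordK ?ltnS ?addn_gt0 ?p_gt0 //.
    by move: (nat_of_ord i) => k; rewrite p1; case: k => [|[]].
  move: Av; rewrite EA inE => /eqP Ev.
  exists (wt G ord0 v), 1; do 2!split=> //; constructor 2; split=> //; first by rewrite Ev.
  move=> i j ij nij; apply: outside => //; rewrite -negb_and; apply: contra nij.
  rewrite EA !inE => /andP[/orP[]/eqP Ei /orP[]/eqP Ej]; subst i j;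
    rewrite ?adj_irrefl // in ij *.
  by rewrite setUC.
- have p2 : p = 2 by rewrite -(card_Aset p q).
  have EA : Aset p q = [set inord 1; inord 2].
    have pq2 : 1 < p + q by rewrite (leq_trans _ (leq_addr q p)) // p2.
    apply/setP=> i; rewrite !inE -!val_eqE /= !inordK ?ltnS ?(ltnW pq2) //.
    by move: (nat_of_ord i) => k; rewrite p2; case: k => [|[|[]]].
  have [A_1 A_2] : inord 1 \in Aset p q /\ inord 2 \in Aset p q.
    by rewrite EA !inE !eqxx orbT.
  (* The maximum keeps [b] positive when the edge between 1 and 2 is absent. *)
  exists (wt G ord0 v), (maxn 1 (wt G (inord 1) (inord 2))); split=> //; split; first exact: leq_maxl.
  constructor 3; split=> //; try exact: eq_wt; first by move/maxn_idPr.
  move=> i j ij nij; apply: outside => //; rewrite -negb_and; apply: contra nij.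
  rewrite EA !inE => /andP[/or3P[]/eqP Ei /or3P[]/eqP Ej]; subst i j;
    rewrite ?adj_irrefl // in ij *; rewrite ?eqxx ?orbT //.
  + by rewrite setUC eqxx.
  + by rewrite [[set inord 2; ord0]]setUC eqxx orbT.
  + by rewrite [[set inord 2; inord 1]]setUC eqxx !orbT.
Qed.
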